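(* Let $X$ be a $T_1$ star-Rothberger space with countable extent. Then its Alexandroff duplicate $A(X)$ is star-Rothberger.
   Context: The extent of $X$ is $e(X)=\sup\{|Y| : Y \text{ is a closed and discrete subspace of } X\}$; $X$ has countable extent if $e(X)\leq\omega$, i.e. every closed discrete subspace is countable. The Alexandroff duplicate of $X$ is $A(X)=X\times\{0,1\}$, where each point of $X\times\{1\}$ is isolated and a basic neighbourhood of $\langle x,0\rangle$ is a set of the form $(U\times\{0\})\cup((U\times\{1\})\setminus\{\langle x,1\rangle\})$ with $U$ a neighbourhood of $x$ in $X$. For a subset $A$ of a space $Z$ and a collection $\mathcal{P}$ of subsets of $Z$, $St(A,\mathcal{P})=\bigcup\{B\in\mathcal{P} : A\cap B\neq\emptyset\}$. $Z$ is star-Rothberger if for each sequence $(\mathcal{U}_n)_{n\in\mathbb{N}}$ of open covers of $Z$ there are $V_n\in\mathcal{U}_n$ such that $\{St(V_n,\mathcal{U}_n) : n\in\mathbb{N}\}$ covers $Z$. *)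

(* Defs.v *)
From HB Require Import structures.
From mathcomp Require Import all_boot.
From mathcomp Require Import boolp classical_sets functions cardinality filter.
From mathcomp Require Import topology.

Set Implicit Arguments.
Unset Strict Implicit.
Unset Printing Implicit Defensive.

Local Open Scope classical_set_scope.

(* Points outside Y are isolated in the library's [subspace Y], so the
   equation says exactly that the subspace topology on Y is discrete. *)
Definition discrete_subspace (X : topologicalType) (Y : set X) : Prop :=
  @nbhs (subspace Y) (subspace Y) = principal_filter.

(* e(X) <= omega *)
Definition countable_extent (X : topologicalType) : Prop :=
  forall Y : set X, closed Y -> discrete_subspace Y -> countable Y.

Definition star (Z : Type) (A : set Z) (P : set (set Z)) : set Z :=
  \bigcup_(B in [set B | P B /\ A `&` B !=set0]) B.

Definition open_cover (Z : topologicalType) (U : set (set Z)) : Prop :=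
  U `<=` open /\ cover U id = [set: Z].

Definition star_rothberger (Z : topologicalType) : Prop :=
  forall U : nat -> set (set Z), (forall n, open_cover (U n)) ->
  exists2 V : nat -> set Z, (forall n, U n (V n)) &
    cover [set: nat] (fun n => star (V n) (U n)) = [set: Z].

(* An alias of X * bool, so as not to inherit the product topology;
   (x, false) stands for <x, 0> and (x, true) for <x, 1>. *)
Definition alexandroff_duplicate (X : Type) : Type := (X * bool)%type.

HB.instance Definition _ (X : choiceType) :=
  Choice.copy (alexandroff_duplicate X) (X * bool)%type.

Definition duplicate_basic (X : Type) (x : X) (U : set X) :
    set (alexandroff_duplicate X) :=
  (U `*` [set false]) `|` ((U `*` [set true]) `\ (x, true)).

(* The basic sets at the points (x, false) satisfy the axioms of a
   neighbourhood system only if X is T1, so the topology is introduced through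
   its open sets; duplicate_nbhs0 and duplicate_nbhs1 check that for T1 spaces
   the neighbourhoods are the intended ones. *)
Definition duplicate_open (X : topologicalType)
    (W : set (alexandroff_duplicate X)) : Prop :=
  forall x, W (x, false) -> exists2 U, nbhs x U & duplicate_basic x U `<=` W.

Lemma duplicate_openT (X : topologicalType) : @duplicate_open X setT.
Proof. by move=> x _; exists setT => //; exact: filterT. Qed.

Lemma duplicate_openI (X : topologicalType) : setI_closed (@duplicate_open X).
Proof.
move=> W W' oW oW' x [/oW[U Ux UW] /oW'[U' Ux' UW']].
exists (U `&` U'); first exact: filterI.
by move=> q [[[? ?] ?]|[[[? ?] ?] ?]]; split;
  [apply: UW; left|apply: UW'; left|apply: UW; right|apply: UW'; right].
Qed.

Lemma duplicate_open_bigU (X : topologicalType) (I : Type)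
    (f : I -> set (alexandroff_duplicate X)) :
  (forall i, duplicate_open (f i)) -> duplicate_open (\bigcup_i f i).
Proof.
move=> of_ x [i _ /of_[U Ux Uf]]; exists U => //.
by apply: subset_trans Uf _; exact: bigcup_sup.
Qed.

HB.instance Definition _ (X : topologicalType) :=
  isOpenTopological.Build (alexandroff_duplicate X)
    (@duplicate_openT X) (@duplicate_openI X) (@duplicate_open_bigU X).

Lemma duplicate_nbhs1 (X : topologicalType) (x : X)
    (W : set (alexandroff_duplicate X)) :
  nbhs ((x, true) : alexandroff_duplicate X) W <-> W (x, true).
Proof.
split; first exact: nbhs_singleton.
move=> Wx; exists [set (x, true)]; split=> //; last by move=> _ ->.
Qed.

Lemma duplicate_nbhs0 (X : topologicalType) (x : X)
    (W : set (alexandroff_duplicate X)) : accessible_space X ->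
  nbhs ((x, false) : alexandroff_duplicate X) W <->
  exists2 U, nbhs x U & duplicate_basic x U `<=` W.
Proof.
move=> T1; split.
  move=> [B [oB Bx BW]]; have [U Ux UB] := oB _ Bx.
  by exists U => //; exact: subset_trans BW.
move=> [U Ux UW]; exists (duplicate_basic x U°); split.
- move=> y [[/= Uy _]|[[]]//].
  have [->|/eqP yx] := EM (y = x); first by exists U° => //; exact: nbhs_interior.
  exists (U° `&` [set z | z != x]).
    apply: filterI; first exact: nbhs_interior.
    have /T1[D [oD yD xD]] := yx.
    rewrite inE in yD; rewrite inE in xD.
    have Dy : nbhs y D by apply: open_nbhs_nbhs.
    by apply: filterS Dy => z Dz; apply/eqP => zx; apply: xD; rewrite -zx.
  move=> [z b] [[[/= Uz zx] /= ->]|[[[/= Uz zx] /= ->] _]]; first by left.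
  by right; split=> // -[zx']; rewrite zx' eqxx in zx.
- by left; split=> //=; exact: nbhs_singleton (nbhs_interior Ux).
- move=> q [[Uq ?]|[[Uq ?] ?]]; apply: UW; [left|right] => //.
    by split=> //; exact: interior_subset.
  by split=> //; split=> //; exact: interior_subset.
Qed.

(* Main.v *)
(** For an open cover of A(X), the traces of its members on X x {0} form an open
cover of X, so the terms of even index of the sequence already yield stars whose
union G contains X x {0}.  As G is open, every point of X has a neighbourhood
containing at most one point of E = {x | (x, 1) not in G}; hence E is closed and
discrete, therefore countable, and the terms of odd index cover E x {1}. *)
Require Import Defs.
From mathcomp Require Import all_boot.
From mathcomp Require Import boolp classical_sets functions cardinality filter.
From mathcomp Require Import topology.

Set Implicit Arguments.
Unset Strict Implicit.
Unset Printing Implicit Defensive.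

Local Open Scope classical_set_scope.

Lemma sub_star (Z : Type) (A : set Z) (P : set (set Z)) : P A -> A `<=` star A P.
Proof. by move=> PA z Az; exists A => //; split=> //; exists z. Qed.

Lemma open_cover_ex (Z : topologicalType) (U : set (set Z)) (z : Z) :
  open_cover U -> exists2 B, U B & B z.
Proof. by move=> [_ Ucov]; have : [set: Z] z by []; rewrite -Ucov => -[B]; exists B. Qed.

Lemma star_open (Z : topologicalType) (A : set Z) (U : set (set Z)) :
  open_cover U -> open (star A U).
Proof. by move=> [Uo _]; apply: bigcup_open => B [/Uo]. Qed.

(** A point of the closure has a neighbourhood in which only it can belong to [E]; as this
    neighbourhood meets [E], the point is in [E]. *)
Lemma locally_subsingleton_closed (X : topologicalType) (E : set X) :
  (forall x, \forall y \near x, E y -> y = x) -> closed E.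
Proof.
move=> Esub x Ex; have [y [Ey /(_ Ey) yx]] := Ex _ (Esub x).
by rewrite -yx.
Qed.

Lemma locally_subsingleton_discrete (X : topologicalType) (E : set X) :
  (forall x, \forall y \near x, E y -> y = x) -> discrete_subspace E.
Proof.
move=> Esub; apply/funext => x; apply/seteqP; split=> A; rewrite principal_filterP.
  exact: (@nbhs_singleton (subspace E)).
move=> Ax; have [Ex|nEx] := EM (E x).
  (* At a point of [E], the neighbourhood given by [Esub] traces only [x] on [E]; outside [E],
     neighbourhoods in the subspace are principal by construction. *)
  by rewrite /nbhs /= -nbhs_subspace_in//; apply: filterS (Esub x) => y yx /yx ->.
by rewrite /nbhs /= -nbhs_subspace_out// => y ->.
Qed.

Lemma duplicate_trace_open (X : topologicalType)
    (B : set (alexandroff_duplicate X)) :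
  open B -> open [set x : X | B (x, false)].
Proof.
move=> oB; rewrite openE => x /= Bx; have [U Ux UB] := oB x Bx.
by apply: filterS Ux => y Uy; apply: UB; left.
Qed.

(** Traces that meet in X come from members that meet in X x {0}, so a selection among the traces
    lifts to the covers of A(X) with its stars. *)
Lemma star_rothberger_trace (X : topologicalType)
    (U : nat -> set (set (alexandroff_duplicate X))) :
  star_rothberger X -> (forall n, open_cover (U n)) ->
  exists2 V : nat -> set (alexandroff_duplicate X), (forall n, U n (V n)) &
    forall x, exists n, star (V n) (U n) (x, false).
Proof.
pose trace (B : set (alexandroff_duplicate X)) := [set x : X | B (x, false)].
move=> srX Ucov; have traces_cover n : open_cover (trace @` U n).
  split; first by move=> _ [B UB <-]; apply: duplicate_trace_open; exact: (Ucov n).1.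
  apply/seteqP; split=> // x _.
  have [B UB Bx] := open_cover_ex ((x, false) : alexandroff_duplicate X) (Ucov n).
  by exists (trace B) => //; exists B.
have [T TU Tcov] := srX _ traces_cover.
have /choice[V VT] n : exists B, U n B /\ trace B = T n.
  by have [B] := TU n; exists B.
exists V => [n|x]; first by have [] := VT n.
have : [set: X] x by []; rewrite -Tcov => -[n _ [_ [[B UB <-] [y [Ty By]]] Bx]].
exists n, B => //; split=> //; exists (y, false); split=> //.
by move: Ty; rewrite -(VT n).2.
Qed.

(** A basic neighbourhood of (x, 0) inside [G] omits only (x, 1) among the points (y, 1) with y in
    [U]. *)
Lemma duplicate_open_isolates (X : topologicalType)
    (G : set (alexandroff_duplicate X)) :
  open G -> (forall x, G (x, false)) ->
  forall x, \forall y \near x, ~ G (y, true) -> y = x.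
Proof.
move=> oG G0 x; have [U Ux UG] := oG x (G0 x).
apply: filterS Ux => y Uy; apply: contra_notP => yx.
by apply: UG; right; split=> // -[].
Qed.

Theorem theorem4p22 (X : topologicalType) :
  accessible_space X -> star_rothberger X -> countable_extent X ->
  star_rothberger (alexandroff_duplicate X).
Proof.
move=> _ srX ceX U Ucov.
have [V VU Vcov] := star_rothberger_trace srX (fun n => Ucov n.*2).
(* [D] only witnesses that the covers of odd index are nonempty. *)
have [D DU _] := star_rothberger_trace srX (fun n => Ucov n.*2.+1).
pose G := \bigcup_n star (V n) (U n.*2).
have oG : open G by apply: bigcup_open => n _; exact: star_open.
have G0 x : G (x, false) by have [n] := Vcov x; exists n.
pose E := [set x : X | ~ G (x, true)].
have Esub : forall x, \forall y \near x, E y -> y = x.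
  exact: duplicate_open_isolates.
have /countable_injP[f /= finj] : countable E.
  by apply: ceX; [exact: locally_subsingleton_closed
                 |exact: locally_subsingleton_discrete].
(* The point [x] of [E] is handled at stage [f x]; since [f] is injective on [E], each stage serves
   at most one point and one member suffices. *)
have /choice[W WU] n : exists B, U n.*2.+1 B /\
    forall x, E x -> f x = n -> B (x, true).
  have [[x Ex fx]|noE] := EM (exists2 x, E x & f x = n).
    have [B UB Bx] := open_cover_ex
      ((x, true) : alexandroff_duplicate X) (Ucov n.*2.+1).
    exists B; split=> // y Ey fy.
    by rewrite (finj y x) ?inE// fx.
  by exists (D n); split=> // x Ex fx; case: noE; exists x.
exists (fun n => if odd n then W n./2 else V n./2) => [n|].
  rewrite -{1}(odd_double_half n); case: (odd n); last exact: VU.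
  exact: (WU _).1.
have GV z : G z -> exists n,
    star (if odd n then W n./2 else V n./2) (U n) z.
  by move=> [n _ Vz]; exists n.*2; rewrite odd_double doubleK.
apply/seteqP; split=> // -[x b] _.
suff [n nP] : exists n, star (if odd n then W n./2 else V n./2) (U n) (x, b).
  by exists n.
case: b; last exact: GV (G0 x).
have [Gx|Ex] := EM (G (x, true)); first exact: GV.
(* The half of this odd index is [f x], and [W (f x)] contains (x, 1) and lies in its own star. *)
exists (f x).*2.+1; rewrite /= odd_double /= uphalf_double.
by apply: sub_star; [exact: (WU _).1 | exact: (WU _).2].
Qed.
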